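(* Let $S=\{s_1,\dots,s_N\}\subset\mathbb{R}^n$ be a finite set of $N$ distinct points, let $P=\mathbf{conv}(S)$, and let $m$ be the number of independent equality constraints satisfied by all points of $S$ (so $\dim P=n-m$). For constants $\varepsilon>0$ and $M>0$, consider the mixed integer program in the variables $\pi\in\mathbb{R}^n$, $\pi_0\in\mathbb{R}$, $\theta=(\theta_1,\dots,\theta_N)$: $$\begin{aligned}\max\ & \sum_{i=1}^N\theta_i\\ \text{s.t. } & -\pi^T s_i+\pi_0\le (1-\theta_i)M, && i=1,\dots,N,\\ & \pi^T s_i-\pi_0\le(\theta_i-1)\varepsilon, && i=1,\dots,N,\\ & \sum_{i=1}^N\theta_i\le N-1,\\ & \sum_{i=1}^N\theta_i\ge n-m,\\ & \theta_i\in\{0,1\}, && i=1,\dots,N.\end{aligned}$$ Then, for $\varepsilon$ sufficiently small and $M$ sufficiently large (i.e. for $M/\varepsilon$ sufficiently large, depending on $S$), solving this program provides a facet of $P$: the program has an optimal solution, and for every optimal solution $(\pi,\pi_0,\theta)$ the inequality $\pi^Tx\le\pi_0$ is valid for $P$ and the face $\{x\in P:\pi^Tx=\pi_0\}$ is a facet of $P$.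
   Context: An inequality $\pi^Tx\le\pi_0$ is valid for a polytope $P$ if it is satisfied by all points of $P$; then $f=\{x\in P:\pi^Tx=\pi_0\}$ is a face of $P$, represented by $(\pi,\pi_0)$. The dimension of a set is the maximum number of affinely independent points in it minus one (so the empty set has dimension $-1$). A face $F$ of $P$ is a facet if $\dim F=\dim P-1$. The number $m$ of independent equality constraints is the rank of a matrix $\tilde A$ such that $\{x:\tilde Ax=\tilde b\}$ is the affine hull of $S$. *)

(* Defs.v *)
From mathcomp Require Import all_boot all_order all_algebra.
From mathcomp Require Import boolp classical_sets reals.

Set Implicit Arguments.
Unset Strict Implicit.
Unset Printing Implicit Defensive.

Import Order.TTheory GRing.Theory Num.Theory.

Local Open Scope classical_set_scope.
Local Open Scope ring_scope.

Definition dot (R : realType) (n : nat) (u v : 'cV[R]_n) : R :=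
  (u^T *m v) 0 0.

Definition conv_hull (R : realType) (n : nat) (A : set 'cV[R]_n) :
    set 'cV[R]_n :=
  [set x | exists k (y : 'I_k -> 'cV[R]_n) (l : 'I_k -> R),
     [/\ forall i, A (y i), forall i, 0 <= l i, \sum_i l i = 1
       & x = \sum_i l i *: y i]].

Definition aff_hull (R : realType) (n : nat) (A : set 'cV[R]_n) :
    set 'cV[R]_n :=
  [set x | exists k (y : 'I_k -> 'cV[R]_n) (l : 'I_k -> R),
     [/\ forall i, A (y i), \sum_i l i = 1 & x = \sum_i l i *: y i]].

Definition aff_indep (R : realType) (n k : nat) (x : 'I_k -> 'cV[R]_n) : Prop :=
  forall l : 'I_k -> R,
    \sum_i l i = 0 -> \sum_i l i *: x i = 0 -> forall i, l i = 0.

(* The bound making the maximum in [adim] a finite one. *)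
Lemma aff_indep_leq (R : realType) (n k : nat) (x : 'I_k -> 'cV[R]_n) :
  aff_indep x -> (k <= n.+1)%N.
Proof.
move=> xP; pose B : 'M[R]_(k, 1 + n) := row_mx (const_mx 1) (\matrix_i (x i)^T).
suff /eqP <- : row_free B by exact: rank_leq_col.
rewrite -kermx_eq0; apply/rowV0P => v /sub_kermxP.
rewrite mul_mx_row => vB0.
have [v1 v2] : v *m const_mx 1 = 0 :> 'M_1 /\ v *m (\matrix_i (x i)^T) = 0.
  by apply: eq_row_mx; rewrite vB0 row_mx0.
apply/rowP => i; rewrite [RHS]mxE; apply: (xP (fun i => v 0 i)) => //.
  move/matrixP/(_ 0 0): v1; rewrite !mxE => v1.
  by rewrite -[RHS]v1; apply: eq_bigr => j _; rewrite !mxE mulr1.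
apply: trmx_inj; rewrite trmx0 -[RHS]v2; apply/rowP => j.
by rewrite !mxE summxE; apply: eq_bigr => h _; rewrite !mxE.
Qed.

(* Maximum number of affinely independent points of A, minus one; no family of
   more than n + 1 points is affinely independent (aff_indep_leq), and the empty
   family always is, so that adim set0 = -1. *)
Definition adim (R : realType) (n : nat) (A : set 'cV[R]_n) : int :=
  (\max_(k < n.+2 | `[< exists x : 'I_k -> 'cV[R]_n,
                         (forall i, A (x i)) /\ aff_indep x >]) k)%N%:Z - 1.

(* m is the number of independent equality constraints satisfied by all points
   of S: the rank of a matrix of a linear system defining the affine hull. *)
Definition num_eq_constraints (R : realType) (n : nat) (S : set 'cV[R]_n)
    (m : nat) : Prop :=
  exists (p : nat) (A : 'M[R]_(p, n)) (b : 'cV[R]_p),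
    [set x | A *m x = b] = aff_hull S /\ \rank A = m.

Definition valid_ineq (R : realType) (n : nat) (P : set 'cV[R]_n)
    (pi : 'cV[R]_n) (pi0 : R) : Prop :=
  forall x, P x -> dot pi x <= pi0.

Definition face_of (R : realType) (n : nat) (P : set 'cV[R]_n)
    (pi : 'cV[R]_n) (pi0 : R) : set 'cV[R]_n :=
  [set x | P x /\ dot pi x = pi0].

Definition is_face (R : realType) (n : nat) (P F : set 'cV[R]_n) : Prop :=
  exists (pi : 'cV[R]_n) (pi0 : R), valid_ineq P pi pi0 /\ F = face_of P pi pi0.

Definition is_facet (R : realType) (n : nat) (P F : set 'cV[R]_n) : Prop :=
  is_face P F /\ adim F = adim P - 1.

Definition mip_feasible (R : realType) (n N m : nat) (s : 'I_N -> 'cV[R]_n)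
    (eps M : R) (pi : 'cV[R]_n) (pi0 : R) (theta : 'I_N -> R) : Prop :=
  [/\ forall i, - dot pi (s i) + pi0 <= (1 - theta i) * M,
      forall i, dot pi (s i) - pi0 <= (theta i - 1) * eps,
      \sum_i theta i <= N%:R - 1,
      n%:R - m%:R <= \sum_i theta i
    & forall i, theta i = 0 \/ theta i = 1].

Definition mip_optimal (R : realType) (n N m : nat) (s : 'I_N -> 'cV[R]_n)
    (eps M : R) (pi : 'cV[R]_n) (pi0 : R) (theta : 'I_N -> R) : Prop :=
  mip_feasible m s eps M pi pi0 theta /\
  forall pi' pi0' theta', mip_feasible m s eps M pi' pi0' theta' ->
    \sum_i theta' i <= \sum_i theta i.

(* Main.v *)
(* Feasible triples are, up to scaling, the valid inequalities that are not tight
   on all of S, with theta the indicator of the set of tight points.  In the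
   homogenization x |-> (1, x), where dimension plus one is a rank, a tight set
   of rank less than n - m can be strictly enlarged by a ratio test while
   remaining proper.  Hence a tight set of maximal cardinality has rank exactly
   n - m, i.e. it spans a facet, and so contains at least n - m points.  As there
   are finitely many tight sets, a single bound on M / eps lets all of them be
   realized by feasible triples. *)
Require Import Defs.
From mathcomp Require Import all_boot all_order all_algebra.
From mathcomp Require Import boolp classical_sets reals.
From mathcomp Require Import ring.

Import Order.TTheory GRing.Theory Num.Theory.

Local Open Scope classical_set_scope.
Local Open Scope ring_scope.

(** * Homogenized points and tight index sets *)

Definition homog {R : realType} {n : nat} (x : 'cV[R]_n) : 'rV[R]_(1 + n) :=
  row_mx 1%:M x^T.

Definition homog_mx {R : realType} {n k : nat} (x : 'I_k -> 'cV[R]_n) :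
    'M[R]_(k, 1 + n) :=
  \matrix_i homog (x i).

Definition tight {R : realType} {n N : nat} (s : 'I_N -> 'cV[R]_n)
    (pi : 'cV[R]_n) (pi0 : R) : {set 'I_N} :=
  [set i | dot pi (s i) == pi0]%SET.

Definition tight_mx {R : realType} {n N : nat} (s : 'I_N -> 'cV[R]_n)
    (I : {set 'I_N}) : 'M[R]_(#|I|, 1 + n) :=
  homog_mx (fun i : 'I_#|I| => s (enum_val i)).

(** * Affine dimension as a rank in the homogenization *)

Section Homogenization.
Context {R : realType} {n : nat}.
Implicit Types pi x : 'cV[R]_n.

Lemma dotE (u v : 'cV[R]_n) : dot u v = \sum_j u j 0 * v j 0.
Proof. by rewrite /dot mxE; apply: eq_bigr => j _; rewrite mxE. Qed.

Lemma dot_sumr k pi (l : 'I_k -> R) (y : 'I_k -> 'cV[R]_n) :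
  dot pi (\sum_i l i *: y i) = \sum_i l i * dot pi (y i).
Proof.
rewrite /dot mulmx_sumr summxE; apply: eq_bigr => i _.
by rewrite -scalemxAr mxE.
Qed.

Lemma dotZl (a : R) (u v : 'cV[R]_n) : dot (a *: u) v = a * dot u v.
Proof. by rewrite !dotE mulr_sumr; apply: eq_bigr => j _; rewrite mxE mulrA. Qed.

Lemma dotBl (u u' v : 'cV[R]_n) : dot (u - u') v = dot u v - dot u' v.
Proof.
rewrite !dotE -sumrB; apply: eq_bigr => j _.
by rewrite !mxE mulrDl mulNr.
Qed.

(** A column of height [1 + n] encodes an affine functional: constant term on top, linear part
    below. *)
Lemma homog_mul x (c : 'cV[R]_(1 + n)) :
  (homog x *m c) 0 0 = dot (dsubmx c) x + usubmx c 0 0.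
Proof.
rewrite -[in LHS](vsubmxK c) mul_row_col mul1mx mxE addrC; congr (_ + _).
by rewrite /dot !mxE; apply: eq_bigr => j _; rewrite !mxE mulrC.
Qed.

Lemma homog_mulN x pi (pi0 : R) :
  (homog x *m col_mx (- pi0%:M) pi) 0 0 = dot pi x - pi0.
Proof. by rewrite homog_mul col_mxKd col_mxKu !mxE. Qed.

Lemma mul_homog_mx k (l : 'rV[R]_k) (x : 'I_k -> 'cV[R]_n) :
  l *m homog_mx x = row_mx (\sum_i l 0 i)%:M (\sum_i l 0 i *: x i)^T.
Proof.
have -> : homog_mx x = row_mx (const_mx 1) (\matrix_i (x i)^T).
  apply/row_matrixP => i; rewrite rowK row_row_mx rowK /homog.
  by congr row_mx; apply/rowP => j; rewrite !mxE !ord1.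
rewrite mul_mx_row; congr row_mx; apply/rowP => j; rewrite !mxE.
  by rewrite ord1 mulr1n; apply: eq_bigr => i _; rewrite mxE mulr1.
by rewrite summxE; apply: eq_bigr => i _; rewrite !mxE.
Qed.

Lemma homog_sum k (l : 'I_k -> R) (y : 'I_k -> 'cV[R]_n) :
  \sum_i l i = 1 -> homog (\sum_i l i *: y i) = \sum_i l i *: homog (y i).
Proof.
move=> l1.
have := mul_homog_mx k (\row_i l i) y; rewrite mulmx_sum_row.
under eq_bigr do rewrite mxE.
under [X in row_mx X%:M _]eq_bigr do rewrite mxE.
under [X in row_mx _ X^T]eq_bigr do rewrite mxE.
by rewrite l1 /homog => <-; apply: eq_bigr => i _; rewrite rowK.
Qed.

Lemma homog_mx_sub k (x : 'I_k -> 'cV[R]_n) i : (homog (x i) <= homog_mx x)%MS.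
Proof. by rewrite -(rowK (fun i => homog (x i))) row_sub. Qed.

(** The left kernel of [homog_mx x] consists of the affine dependencies: the column of ones gives
    the zero sum, the other columns the vanishing combination. *)
Lemma aff_indepP k (x : 'I_k -> 'cV[R]_n) :
  aff_indep x <-> row_free (homog_mx x).
Proof.
split=> [xP|].
  rewrite -kermx_eq0; apply/rowV0P => v /sub_kermxP.
  rewrite mul_homog_mx -row_mx0 => /eq_row_mx[v1 v2].
  apply/rowP => i; rewrite mxE; apply: (xP (fun i => v 0 i)).
    by move/matrixP/(_ 0 0): v1; rewrite !mxE.
  by apply: trmx_inj; rewrite trmx0.
rewrite -kermx_eq0 => /rowV0P xP l l0 lx0 i.
have /xP/rowP/(_ i) : (\row_i l i <= kermx (homog_mx x))%MS.
  apply/sub_kermxP; rewrite mul_homog_mx.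
  under eq_bigr do rewrite mxE.
  under [X in row_mx _ X^T]eq_bigr do rewrite mxE.
  by rewrite l0 lx0 raddf0 trmx0 row_mx0.
by rewrite !mxE.
Qed.

Lemma adim_homog_mx k (y : 'I_k -> 'cV[R]_n) (A : set 'cV[R]_n) :
  (forall i, A (y i)) -> (forall x, A x -> (homog x <= homog_mx y)%MS) ->
  adim A = (\rank (homog_mx y))%:Z - 1.
Proof.
move=> Ay Asub; rewrite /adim; congr (Posz _ - 1); apply/eqP.
rewrite eqn_leq; apply/andP; split.
  apply/bigmax_leqP => j /asboolP[x [Ax /aff_indepP]].
  rewrite /row_free => /eqP <-; apply: mxrankS.
  by apply/row_subP => i; rewrite rowK; apply: Asub.
have lt_r : (\rank (homog_mx y) < n.+2)%N by rewrite ltnS rank_leq_col.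
apply: (leq_bigmax_cond (Ordinal lt_r)); apply/asboolP.
(* A maximal free choice of rows is a family from [A] that attains the rank bound. *)
exists (fun i => y (maxrankfun (homog_mx y) i)); split=> //.
apply/aff_indepP.
suff -> : homog_mx (fun i => y (maxrankfun (homog_mx y) i)) =
    rowsub (maxrankfun (homog_mx y)) (homog_mx y) by exact: maxrowsub_free.
by apply/row_matrixP => i; rewrite row_rowsub !rowK.
Qed.

Lemma homog_mx_aff_hull k (y : 'I_k -> 'cV[R]_n) x :
  aff_hull (range y) x -> (homog x <= homog_mx y)%MS.
Proof.
case=> j [z [l [yz l1 ->]]]; rewrite homog_sum //; apply: summx_sub => i _.
by apply: scalemx_sub; have [h _ <-] := yz i; apply: homog_mx_sub.
Qed.

Lemma range_sub_aff_hull k (y : 'I_k -> 'cV[R]_n) i : aff_hull (range y) (y i).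
Proof.
exists 1%N, (fun=> y i), (fun=> 1); split=> [_||]; first by exists i.
  by rewrite big_ord1.
by rewrite big_ord1 scale1r.
Qed.

Lemma range_sub_conv_hull k (y : 'I_k -> 'cV[R]_n) i : conv_hull (range y) (y i).
Proof.
exists 1%N, (fun=> y i), (fun=> 1); split=> [_|_||]; first by exists i.
- exact: ler01.
- by rewrite big_ord1.
by rewrite big_ord1 scale1r.
Qed.

Lemma conv_sub_aff_hull (A : set 'cV[R]_n) x : conv_hull A x -> aff_hull A x.
Proof. by case=> k [y [l [Ay _ l1 ->]]]; exists k, y, l. Qed.

Lemma adim_conv_hull k (y : 'I_k -> 'cV[R]_n) :
  adim (conv_hull (range y)) = (\rank (homog_mx y))%:Z - 1.
Proof.
apply: adim_homog_mx => [i|x /conv_sub_aff_hull]; first exact: range_sub_conv_hull.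
exact: homog_mx_aff_hull.
Qed.

(* With [A x0 = b], the pairs [(t, v)] with [A v = t b] form both the row space
   of [homog_mx y] and the kernel of a matrix with the row space of [A^T]. *)
Lemma rank_homog_mx k (y : 'I_k -> 'cV[R]_n) m : (0 < k)%N ->
  num_eq_constraints (range y) m -> (\rank (homog_mx y) + m = n.+1)%N.
Proof.
move=> k_gt0 [p [A [b [Ab <-]]]].
have AbP x : (A *m x = b) <-> aff_hull (range y) x by rewrite -Ab.
pose x0 := y (Ordinal k_gt0).
have x0b : A *m x0 = b by apply/AbP; exact: range_sub_aff_hull.
pose B : 'M_(1 + n, p) := col_mx (- b^T) A^T.
have rankB : \rank B = \rank A.
  rewrite -(mxrank_tr A); apply/eqP; rewrite eqn_leq; apply/andP; split.
    (* Since [b = A *m x0], the extra row [- b^T] lies in the row space of [A^T]. *)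
    apply: mxrankS; rewrite col_mx_sub submx_refl andbT.
    by rewrite eqmx_opp -x0b trmx_mul submxMl.
  by apply: mxrankS; rewrite -addsmxE addsmxSr.
have mulB t (v : 'cV_n) : row_mx t%:M v^T *m B = (A *m v - t *: b)^T.
  rewrite mul_row_col mulmxN mul_scalar_mx -trmx_mul addrC linearB /=.
  by congr (_ - _); apply/matrixP => i j; rewrite !mxE.
suff eqB : (homog_mx y :=: kermx B)%MS.
  by rewrite eqB mxrank_ker rankB subnK // (leq_trans (rank_leq_col A)).
apply/eqmxP/andP; split.
  apply/row_subP => i; rewrite rowK; apply/sub_kermxP.
  rewrite mulB scale1r; apply: trmx_inj; rewrite trmxK trmx0.
  by apply/eqP; rewrite subr_eq0; apply/eqP/AbP; exact: range_sub_aff_hull.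
apply/row_subP => i.
move: (row i (kermx B)) (row_sub i (kermx B)) => u /sub_kermxP uB.
pose a := lsubmx u 0 0; pose w := (rsubmx u)^T.
have uE : u = row_mx a%:M w^T by rewrite trmxK -mx11_scalar hsubmxK.
have wb : A *m w = a *: b.
  apply/eqP; rewrite -subr_eq0; apply/eqP/trmx_inj.
  by rewrite -mulB -uE uB trmx0.
(* The first coordinate [a] of [u] need not be 1; adding [1 - a] times [homog x0] corrects it and
   lands on a point of the affine hull. *)
have xb : A *m (w + (1 - a) *: x0) = b.
  by rewrite mulmxDr -scalemxAr wb x0b -scalerDl addrC subrK scale1r.
have -> : u = homog (w + (1 - a) *: x0) - (1 - a) *: homog x0.
  rewrite {1}uE /homog scale_row_mx opp_row_mx add_row_mx; congr row_mx.
    by apply/rowP => j; rewrite !mxE ord1 !mulr1n mulr1 subKr.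
  by apply/rowP => j; rewrite !mxE addrK.
apply: addmx_sub; first by apply: homog_mx_aff_hull; apply/AbP.
by rewrite eqmx_opp scalemx_sub // homog_mx_sub.
Qed.

(** * Faces of the hull and the ranks of their tight points *)

Lemma rank_tight_mx N (s : 'I_N -> 'cV[R]_n) (I : {set 'I_N}) :
  (\rank (tight_mx s I) <= #|I|)%N.
Proof. exact: rank_leq_row. Qed.

Lemma tight_mxP N (s : 'I_N -> 'cV[R]_n) (I : {set 'I_N}) p (c : 'M_(1 + n, p)) :
  tight_mx s I *m c = 0 <-> forall i, i \in I -> homog (s i) *m c = 0.
Proof.
split=> [Ic i Ii|Ic].
  have := congr1 (row (enum_rank_in Ii i)) Ic.
  by rewrite row_mul rowK enum_rankK_in // row0.
by apply/row_matrixP => i; rewrite row_mul rowK row0 Ic // enum_valP.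
Qed.

Lemma valid_conv_hull N (s : 'I_N -> 'cV[R]_n) pi (pi0 : R) :
  (forall i, dot pi (s i) <= pi0) -> valid_ineq (conv_hull (range s)) pi pi0.
Proof.
move=> spi x [k [y [l [sy l_ge0 l1 ->]]]]; rewrite dot_sumr.
rewrite -[pi0]mul1r -l1 mulr_suml; apply: ler_sum => i _.
by apply: ler_wpM2l => //; have [j _ <-] := sy i.
Qed.

(** The weighted gaps of a convex combination on the face are nonnegative with sum zero, so every
    point of nonzero weight is tight. *)
Lemma homog_face_sub N (s : 'I_N -> 'cV[R]_n) pi (pi0 : R) x :
  (forall i, dot pi (s i) <= pi0) -> face_of (conv_hull (range s)) pi pi0 x ->
  (homog x <= tight_mx s (tight s pi pi0))%MS.
Proof.
move=> spi [[k [y [l [sy l_ge0 l1 ->]]]]]; rewrite dot_sumr => lpi0.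
have gap_ge0 i : 0 <= l i * (pi0 - dot pi (y i)).
  by rewrite mulr_ge0 // subr_ge0; have [j _ <-] := sy i.
have /eqP : \sum_i l i * (pi0 - dot pi (y i)) = 0.
  under eq_bigr do rewrite mulrBr.
  by rewrite sumrB lpi0 -mulr_suml l1 mul1r subrr.
rewrite psumr_eq0 // => /allP gap0.
rewrite homog_sum //; apply: summx_sub => i _.
have := gap0 i (mem_index_enum i); rewrite /= mulf_eq0 => /orP[/eqP->|].
  by rewrite scale0r sub0mx.
have [j _ <-] := sy i; rewrite subr_eq0 eq_sym => tj.
have jt : j \in tight s pi pi0 by rewrite inE.
apply: scalemx_sub; rewrite -(enum_rankK_in jt jt).
exact: (homog_mx_sub _ (fun i => s (enum_val i))).
Qed.

Lemma adim_face N (s : 'I_N -> 'cV[R]_n) pi (pi0 : R) :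
  (forall i, dot pi (s i) <= pi0) ->
  adim (face_of (conv_hull (range s)) pi pi0) =
    (\rank (tight_mx s (tight s pi pi0)))%:Z - 1.
Proof.
move=> spi; apply: adim_homog_mx => [i|x]; last exact: homog_face_sub.
split; first exact: range_sub_conv_hull.
by have := enum_valP i; rewrite inE => /eqP.
Qed.

Lemma tight_mx_mul0 N (s : 'I_N -> 'cV[R]_n) pi (pi0 : R) :
  tight_mx s (tight s pi pi0) *m col_mx (- pi0%:M) pi = 0.
Proof.
apply/tight_mxP => i; rewrite inE => /eqP spi.
by apply/rowP => j; rewrite ord1 homog_mulN spi subrr mxE.
Qed.

(** The functional of [(pi, pi0)] kills the span of the tight points but not a point that is not
    tight. *)
Lemma rank_tight_ltn N (s : 'I_N -> 'cV[R]_n) pi (pi0 : R) :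
  tight s pi pi0 != [set: 'I_N]%SET ->
  (\rank (tight_mx s (tight s pi pi0)) < \rank (homog_mx s))%N.
Proof.
rewrite -finset.subTset => /subsetPn[j _]; rewrite inE -subr_eq0 => jnt.
rewrite ltn_neqAle; apply/andP; split; last first.
  by apply/mxrankS/row_subP => i; rewrite rowK homog_mx_sub.
apply: contraNneq jnt => eq_rk.
have /submxP[D sD] : (homog_mx s <= tight_mx s (tight s pi pi0))%MS.
  rewrite -(geq_leqif (mxrank_leqif_sup _)) ?eq_rk //.
  by apply/row_subP => i; rewrite rowK homog_mx_sub.
rewrite -homog_mulN -(rowK (fun i => homog (s i))) -row_mul.
by rewrite -/(homog_mx s) sD -mulmxA tight_mx_mul0 mulmx0 !mxE.
Qed.

(* Ratio test: some [c] vanishes on the tight points and on one further point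
   but not on all of S, and the least [t] for which [c - t * (pi, pi0)] is
   nonpositive on S makes an extra point tight. *)
Lemma tight_enlarge N (s : 'I_N -> 'cV[R]_n) pi (pi0 : R) :
  (forall i, dot pi (s i) <= pi0) -> tight s pi pi0 != [set: 'I_N]%SET ->
  ((\rank (tight_mx s (tight s pi pi0))).+1 < \rank (homog_mx s))%N ->
  exists pi' (pi0' : R), [/\ forall i, dot pi' (s i) <= pi0',
    tight s pi' pi0' != [set: 'I_N]%SET &
    tight s pi pi0 \proper tight s pi' pi0'].
Proof.
move=> spi; rewrite -finset.subTset => /subsetPn[j _ jnt] rk_lt.
set I := tight s pi pi0 in jnt rk_lt *.
pose U := (tight_mx s I + homog (s j))%MS.
(* One extra row raises the rank by at most one, too little to reach that of all of S; a column of
   [cokermx U] then separates some point from [U]. *)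
have nsU : ~~ (homog_mx s <= U)%MS.
  apply: contraL rk_lt => /mxrankS le_rk; rewrite -leqNgt (leq_trans le_rk) //.
  rewrite (leq_trans (mxrank_adds_leqif _ _)) // -[leqRHS]addn1 leq_add2l.
  exact: rank_leq_row.
have [i0 [h sh]] : exists i h, (homog (s i) *m cokermx U) 0 h != 0.
  move: nsU; rewrite submxE => /matrix0Pn[i [h ih]]; exists i, h.
  by rewrite -(rowK (fun i => homog (s i))) -row_mul mxE.
pose c := col h (cokermx U).
pose g i := dot pi (s i) - pi0; pose f i := (homog (s i) *m c) 0 0.
have fE i : f i = (homog (s i) *m cokermx U) 0 h.
  by rewrite /f /c colE mulmxA -colE mxE.
have fU i : (homog (s i) <= U)%MS -> f i = 0.
  by rewrite submxE fE => /eqP->; rewrite mxE.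
have fj : f j = 0 by apply: fU; rewrite addsmxSr.
have fI i : i \in I -> f i = 0.
  move=> iI; apply: fU; apply: submx_trans (addsmxSl _ _).
  rewrite -(enum_rankK_in iI iI).
  exact: (homog_mx_sub _ (fun i => s (enum_val i))).
have gI i : i \in I -> g i = 0 by rewrite inE => /eqP; rewrite /g => ->; rewrite subrr.
have gNI i : i \notin I -> g i < 0.
  by rewrite inE => ni; rewrite /g subr_lt0 lt_neqAle ni spi.
(* Off [I], [g] is negative, so [f i - t * g i <= 0] means [t <= f i / g i]: the minimal ratio is
   the greatest admissible [t]. *)
have [k kNI kmin] := @arg_minP _ _ _ j (fun i => i \notin I) (fun i => f i / g i) jnt.
pose r := f k / g k.
pose pi' := dsubmx c - r *: pi; pose pi0' := - usubmx c 0 0 - r * pi0.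
have slackE i : dot pi' (s i) - pi0' = f i - r * g i.
  by rewrite /f homog_mul /pi' /pi0' /g dotBl dotZl; ring.
have tightE i : (i \in tight s pi' pi0') = (f i - r * g i == 0).
  by rewrite inE -subr_eq0 slackE.
exists pi', pi0'; split.
- move=> i; rewrite -subr_le0 slackE.
  have [iI|iNI] := boolP (i \in I); first by rewrite fI // gI // mulr0 subrr.
  by rewrite subr_le0 -ler_ndivlMr ?gNI // kmin.
- rewrite -finset.subTset; apply/negP => /fintype.subsetP T0.
  (* At [j], [f] vanishes and [g] does not, so tightness everywhere would force [r = 0] and then
     [f i0 = 0]. *)
  have := T0 j (finset.in_setT j); rewrite tightE fj sub0r oppr_eq0 mulf_eq0.
  rewrite (lt_eqF (gNI _ jnt)) orbF => /eqP r0.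
  have := T0 i0 (finset.in_setT i0).
  by rewrite tightE r0 mul0r subr0 fE (negPf sh).
- apply/properP; split.
    by apply/fintype.subsetP => i iI; rewrite tightE fI // gI // mulr0 subrr.
  by exists k => //; rewrite tightE /r divfK ?subrr // lt_eqF // gNI.
Qed.

(** There are finitely many index sets, and [0 <= 1] is an inequality with empty tight set to start
    from. *)
Lemma exists_facet_tight N (s : 'I_N -> 'cV[R]_n) : (0 < N)%N ->
  exists pi (pi0 : R), [/\ forall i, dot pi (s i) <= pi0,
    tight s pi pi0 != [set: 'I_N]%SET
  & forall pi' (pi0' : R), (forall i, dot pi' (s i) <= pi0') ->
    tight s pi' pi0' != [set: 'I_N]%SET ->
    (#|tight s pi' pi0'| <= #|tight s pi pi0|)%N].
Proof.
move=> N_gt0.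
pose ex (I : {set 'I_N}) := `[< exists pi (pi0 : R), [/\ forall i, dot pi (s i) <= pi0,
  tight s pi pi0 != [set: 'I_N]%SET & tight s pi pi0 = I] >].
have dot0 i : dot 0 (s i) = 0 by rewrite /dot trmx0 mul0mx mxE.
have ex0 : ex (tight s 0 1).
  apply/asboolP; exists 0, 1; split=> // [i|]; first by rewrite dot0 ler01.
  rewrite -finset.subTset; apply/subsetPn; exists (Ordinal N_gt0) => //.
  by rewrite inE dot0 eq_sym oner_eq0.
case: (@arg_maxnP _ _ ex (fun I : {set 'I_N} => #|I|) ex0).
move=> I /asboolP[pi [pi0 [spi sT ptI]]] Imax.
exists pi, pi0; split=> // pi' pi0' spi' sT'; rewrite ptI; apply: Imax.
by apply/asboolP; exists pi', pi0'.
Qed.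

End Homogenization.

(** * Feasible triples and tight sets *)

Section MixedIntegerProgram.
Context {R : realType} {n N : nat}.
Variables (m : nat) (s : 'I_N -> 'cV[R]_n).
Implicit Types (eps M : R) (pi : 'cV[R]_n).

Definition indicator (I : {set 'I_N}) (i : 'I_N) : R := (i \in I)%:R.

Lemma sum_indicator (I : {set 'I_N}) : \sum_i indicator I i = #|I|%:R.
Proof. by rewrite -natr_sum -sum1_card [in RHS]big_mkcond /=. Qed.

Lemma card_ltT (I : {set 'I_N}) :
  (#|I|%:R <= N%:R - 1 :> R) = (I != [set: 'I_N]%SET).
Proof.
rewrite lerBrDr -mulrSr ler_nat -finset.properT properEcard finset.subsetT.
by rewrite cardsT card_ord.
Qed.

(** [theta i = 1] forces equality at [s i], while [theta i = 0] forces a gap of at least [eps];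
    hence [theta] is the indicator of the tight set. *)
Lemma mip_feasible_tight eps M pi (pi0 : R) theta : 0 < eps ->
  mip_feasible m s eps M pi pi0 theta ->
  [/\ forall i, dot pi (s i) <= pi0, tight s pi pi0 != [set: 'I_N]%SET,
      n%:R - m%:R <= #|tight s pi pi0|%:R :> R
    & \sum_i theta i = #|tight s pi pi0|%:R].
Proof.
move=> eps_gt0 [lo hi le_sum ge_sum th01].
have theta1 i : theta i = 1 -> dot pi (s i) = pi0.
  move=> t1; have := lo i; have := hi i; rewrite t1 !subrr !mul0r.
  by rewrite subr_le0 addrC subr_le0 => ? ?; apply/le_anti/andP.
have theta0 i : theta i = 0 -> dot pi (s i) < pi0.
  move=> t0; rewrite -subr_lt0 (le_lt_trans (hi i)) //.
  by rewrite t0 sub0r mulN1r oppr_lt0.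
have sumE : \sum_i theta i = #|tight s pi pi0|%:R.
  rewrite -sum_indicator; apply: eq_bigr => i _; rewrite /indicator inE.
  have [t|t] := th01 i; first by rewrite lt_eqF ?theta0.
  by rewrite t theta1 ?eqxx.
split=> //; last by rewrite -sumE.
  by move=> i; have [/theta0/ltW|/theta1->] := th01 i.
by rewrite -card_ltT -sumE.
Qed.

(* Multiplying [(pi, pi0)] by the sum of [eps / gap_i] over the points that are
   not tight makes each gap at least [eps]; tight points contribute nothing to
   that sum since [0^-1 = 0]. *)
Lemma mip_feasible_scale pi (pi0 : R) : (forall i, dot pi (s i) <= pi0) ->
  exists K : R, forall eps M : R, 0 < eps -> K <= M / eps ->
  tight s pi pi0 != [set: 'I_N]%SET ->
  n%:R - m%:R <= #|tight s pi pi0|%:R :> R ->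
  exists pi' (pi0' : R),
    mip_feasible m s eps M pi' pi0' (indicator (tight s pi pi0)).
Proof.
move=> spi; pose g i := pi0 - dot pi (s i).
have g_ge0 i : 0 <= g i by rewrite subr_ge0.
have gV_ge0 i : 0 <= (g i)^-1 by rewrite invr_ge0.
have le_sum (F : 'I_N -> R) i : (forall j, 0 <= F j) -> F i <= \sum_j F j.
  by move=> F0; rewrite (bigD1 i) //= lerDl sumr_ge0.
pose V := \sum_j (g j)^-1.
have V_ge0 : 0 <= V by apply: sumr_ge0.
(* After scaling by [eps * V], each gap is at most [eps * V * \sum_i g i], which this bound keeps
   below [M]. *)
exists ((\sum_i g i) * V) => eps M eps_gt0; rewrite ler_pdivlMr // => leM sT le_card.
have gapE i : (eps * V) * pi0 - dot ((eps * V) *: pi) (s i) = eps * V * g i.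
  by rewrite dotZl -mulrBr.
exists ((eps * V) *: pi), ((eps * V) * pi0); split=> [i|i|||i].
- rewrite addrC gapE /indicator inE -subr_eq0 -opprB oppr_eq0 -/(g i).
  have [->|gi0] := eqVneq (g i) 0; first by rewrite mulr0 subrr mul0r.
  rewrite subr0 mul1r (le_trans _ leM) // [leRHS]mulrC -mulrA ler_pM2l //.
  by rewrite mulrC ler_wpM2r // (le_sum g).
- rewrite -opprB gapE /indicator inE -subr_eq0 -opprB oppr_eq0 -/(g i).
  have [->|gi0] := eqVneq (g i) 0; first by rewrite mulr0 oppr0 subrr mul0r.
  rewrite sub0r mulN1r lerN2 -mulrA ler_peMr ?(ltW eps_gt0) //.
  by rewrite -[leLHS](mulVf gi0) ler_wpM2r // (le_sum (fun j => (g j)^-1)).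
- by rewrite sum_indicator card_ltT.
- by rewrite sum_indicator.
- by rewrite /indicator; case: (i \in _); [right|left].
Qed.

(** The conclusion depends on [(pi, pi0)] only through its tight set, so one constant per index set
    suffices, and the sum of their absolute values dominates them all. *)
Lemma exists_uniform_bound : exists K : R, forall eps M pi (pi0 : R),
  0 < eps -> K <= M / eps -> (forall i, dot pi (s i) <= pi0) ->
  tight s pi pi0 != [set: 'I_N]%SET ->
  n%:R - m%:R <= #|tight s pi pi0|%:R :> R ->
  exists pi' (pi0' : R),
    mip_feasible m s eps M pi' pi0' (indicator (tight s pi pi0)).
Proof.
have /choice[K KP] (I : {set 'I_N}) : exists K : R, forall eps M pi (pi0 : R),
    0 < eps -> K <= M / eps -> (forall i, dot pi (s i) <= pi0) ->
    tight s pi pi0 = I -> I != [set: 'I_N]%SET -> n%:R - m%:R <= #|I|%:R :> R ->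
    exists pi' (pi0' : R), mip_feasible m s eps M pi' pi0' (indicator I).
  have [[pi [pi0 [spi <-]]]|noI] := pselect (exists pi (pi0 : R),
    (forall i, dot pi (s i) <= pi0) /\ tight s pi pi0 = I).
    have [K KP] := mip_feasible_scale _ _ spi.
    by exists K => eps M _ _ eps_gt0 leK _ _; apply: KP.
  exists 0 => eps M pi pi0 _ _ spi tI; exfalso; apply: noI.
  by exists pi, pi0.
exists (\sum_I `|K I|) => eps M pi pi0 eps_gt0 leK spi.
apply: KP => //; apply: le_trans leK; apply: (le_trans (ler_norm _)).
by rewrite (bigD1 (tight s pi pi0)) //= lerDl sumr_ge0.
Qed.

End MixedIntegerProgram.

(** * Maximal tight sets and optimal solutions *)

Theorem proposition1 (R : realType) (n N m : nat) (s : 'I_N -> 'cV[R]_n)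
    (N_gt0 : (0 < N)%N) (s_inj : injective s)
    (hm : num_eq_constraints (range s) m) :
  exists K : R, forall eps M : R, 0 < eps -> 0 < M -> K <= M / eps ->
    (exists (pi : 'cV[R]_n) (pi0 : R) (theta : 'I_N -> R),
       mip_optimal m s eps M pi pi0 theta) /\
    (forall (pi : 'cV[R]_n) (pi0 : R) (theta : 'I_N -> R),
       mip_optimal m s eps M pi pi0 theta ->
       valid_ineq (conv_hull (range s)) pi pi0 /\
       is_facet (conv_hull (range s)) (face_of (conv_hull (range s)) pi pi0)).
Proof.
have rk := rank_homog_mx _ _ _ N_gt0 hm.
have [K KP] := exists_uniform_bound m s.
exists K => eps M eps_gt0 _ leK; split.
  have [pi [pi0 [spi sT max_card]]] := exists_facet_tight _ s N_gt0.
  (* With fewer than [n - m] tight points their rank would fall short of [n + 1 - m] by more than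
     one, and an enlargement would contradict maximality. *)
  have le_card : n%:R - m%:R <= #|tight s pi pi0|%:R :> R.
    rewrite lerBlDr -natrD ler_nat -ltnS -rk -addSn leq_add2r.
    rewrite leqNgt; apply/negP => lt_card.
    have [|pi' [pi0' [spi' sT' lt_t]]] := tight_enlarge _ _ _ _ spi sT.
      by apply: leq_ltn_trans lt_card; rewrite ltnS rank_tight_mx.
    by have := max_card _ _ spi' sT'; rewrite leqNgt proper_card.
  have [pi' [pi0' feas]] := KP _ _ _ _ eps_gt0 leK spi sT le_card.
  exists pi', pi0', (indicator (tight s pi pi0)); split=> // pi'' pi0'' theta''.
  case/mip_feasible_tight=> // spi'' sT'' _ ->.
  by rewrite sum_indicator ler_nat max_card.
move=> pi pi0 theta [feas opt].
have [spi sT le_card sumE] := mip_feasible_tight _ _ _ _ _ _ _ eps_gt0 feas.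
have valid := valid_conv_hull _ _ _ _ spi.
split=> //; split; first by exists pi, pi0.
rewrite adim_face // adim_conv_hull.
suff -> : \rank (homog_mx s) = (\rank (tight_mx s (tight s pi pi0))).+1.
  by rewrite intS [1 + _]addrC addrK.
(* If the rank dropped by more than one, an enlarged tight set would still satisfy the cardinality
   bounds and, after scaling, beat the optimum. *)
apply/eqP; rewrite eqn_leq rank_tight_ltn // andbT leqNgt; apply/negP => lt_rk.
have [pi' [pi0' [spi' sT' lt_t]]] := tight_enlarge _ _ _ _ spi sT lt_rk.
have lt_card := proper_card lt_t.
have le_card' : n%:R - m%:R <= #|tight s pi' pi0'|%:R :> R.
  by apply: le_trans le_card _; rewrite ler_nat ltnW.
have [pi'' [pi0'' feas']] := KP _ _ _ _ eps_gt0 leK spi' sT' le_card'.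
have := opt _ _ _ feas'.
by rewrite sumE sum_indicator ler_nat leqNgt lt_card.
Qed.
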